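(* For all real numbers $\alpha,\beta>0$, let $X_{\alpha,\beta}$ be a Gamma random variable with shape parameter $\alpha$ and scale parameter $\beta$. Then, for all $\alpha,\beta>0$, $$P\{X_{\alpha,\beta}\le E[X_{\alpha,\beta}]\}>\frac{1}{2},$$ and $$\inf_{\alpha>0,\,\beta>0}P\{X_{\alpha,\beta}\le E[X_{\alpha,\beta}]\}=\frac{1}{2}.$$
   Context: A Gamma random variable $X_{\alpha,\beta}$ with shape parameter $\alpha>0$ and scale parameter $\beta>0$ has probability density function $f_{\alpha,\beta}(x)=\dfrac{x^{\alpha-1}e^{-x/\beta}}{\Gamma(\alpha)\beta^{\alpha}}$ for $x>0$ (and $0$ otherwise). Here $P$ denotes probability and $E$ denotes expectation. *)

(* Defs.v *)
From HB Require Import structures.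
From mathcomp Require Import all_boot all_order all_algebra.
From mathcomp Require Import all_classical all_reals all_analysis.

Set Implicit Arguments.
Unset Strict Implicit.
Unset Printing Implicit Defensive.

Import Order.TTheory GRing.Theory Num.Theory.
Import numFieldNormedType.Exports.

Local Open Scope classical_set_scope.
Local Open Scope ring_scope.

(* Euler's integral. [Rintegral] is the real part ([fine]) of the extended real
   Lebesgue integral, which is finite exactly when 0 < a. *)
Definition gamma_fun {R : realType} (a : R) : R :=
  \int[lebesgue_measure]_(t in `]0, +oo[) (t `^ (a - 1) * expR (- t)).

(* The parameter b is a scale, not a rate. *)
Definition gamma_pdf {R : realType} (a b x : R) : R :=
  if 0 < x then x `^ (a - 1) * expR (- (x / b)) / (gamma_fun a * b `^ a)
  else 0.

Definition gamma_distributed {R : realType} {d : measure_display}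
    {T : measurableType d} (P : probability T R) (X : {RV P >-> R})
    (a b : R) : Prop :=
  forall A : set R, measurable A ->
    distribution P X A =
    (\int[lebesgue_measure]_(x in A) (gamma_pdf a b x)%:E)%E.

(* Main.v *)
Require Import Defs.
From HB Require Import structures.
From mathcomp Require Import all_boot all_order all_algebra.
From mathcomp Require Import all_classical all_reals all_analysis.
From mathcomp Require Import measurable_realfun.
From mathcomp Require Import ring lra.

Set Implicit Arguments.
Unset Strict Implicit.
Unset Printing Implicit Defensive.

Import Order.TTheory GRing.Theory Num.Theory.
Import numFieldNormedType.Exports.

Local Open Scope classical_set_scope.
Local Open Scope ring_scope.

(* Write m = a b for the mean and f for the density. The weight
   w x = sg (m - x) - (m - x) / c is odd about m and integrates against f to
   2 P(X <= m) - 1, whatever c > 0 is, because X - m is centred. Folding the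
   integral at m turns it into half the integral of w x (f x - f (2m - x)). The
   function log f(m + t) - log f(m - t) vanishes at t = 0 and, on (0, m), is
   either nonpositive or convex, so f x - f (2m - x) changes sign only once to
   the left of m; taking c to be the crossing distance makes the folded
   integrand nonnegative.

   For the infimum take b = 1 and a = m = s^2 >= 1. The same logarithm is at
   least - 2 t / m, so sg (m - x) (f x - f (2m - x)) is at most
   2 |x - m| / m times f x + f (2m - x), and 2 |x - m| <= (x - m)^2 / s + s
   bounds 2 P(X <= m) - 1 by (Var X / s + s) / m = 2 / s. *)

(** * Integration against a measure given by a density *)

Lemma ge0_integral_density d (T : measurableType d) (R : realType)
    (nu : {finite_measure set T -> \bar R})
    (mu : {sigma_finite_measure set T -> \bar R}) (g f : T -> \bar R) :
  measurable_fun [set: T] g ->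
  (forall A, measurable A -> nu A = \int[mu]_(x in A) g x)%E ->
  measurable_fun [set: T] f -> (forall x, 0 <= f x)%E ->
  (\int[nu]_x f x = \int[mu]_x (f x * g x))%E.
Proof.
move=> mg nug mf f0.
have numu : nu `<< mu.
  apply/null_content_dominatesP => A mA muA0; rewrite nug//.
  by apply: null_set_integral => //; exact: measurable_funTS.
rewrite -(Radon_Nikodym_SigmaFinite.change_of_variables numu)//.
have iRN := Radon_Nikodym_SigmaFinite.f_integrable numu.
have mRN := measurable_int _ iRN.
apply: ae_eq_integral => //; [exact: emeasurable_funM..|].
(* [g] and the Radon-Nikodym derivative have equal integrals over every measurable set, so they
   agree almost everywhere. *)
apply: ae_eqe_mul2l; apply: integral_ae_eq => // E _ mE.
by rewrite -Radon_Nikodym_SigmaFinite.f_integral// nug.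
Qed.

(** * Invariance of Lebesgue integrals under reflections *)

Section reflection.
Context {R : realType}.
Local Notation mu := (@lebesgue_measure R).

Let reflection (c : R) (x : measurableTypeR R) : measurableTypeR R := c - x.

Let measurable_reflection c : measurable_fun setT (reflection c).
Proof. exact: measurable_funB. Qed.

Let lebesgue_measure_reflection (c : R) (A : set R) : measurable A ->
  pushforward mu (reflection c) A = mu A.
Proof.
pose phi_mixin := isMeasurableFun.Build _ _ _ _ _ (measurable_reflection c).
pose phi : {mfun _ >-> _} := HB.pack (reflection c) phi_mixin.
move=> mA; apply/esym.
apply: (@lebesgue_measure_unique _ (pushforward mu phi)) => // _ [[a b]] _ <-.
(* By uniqueness only intervals []a, b]] matter; reflecting swaps which end is closed and keeps the
   length. *)
transitivity (mu `[c - b, c - a[%classic); last first.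
  congr (mu _); apply/seteqP.
  by split => x /=; rewrite /reflection /= !in_itv/=; lra.
rewrite !lebesgue_measure_itv/= !lte_fin ltrD2l ltrN2; case: ifPn => // _.
by congr EFin; lra.
Qed.

Lemma integrable_reflection (c : R) (f : R -> R) :
  mu.-integrable setT (EFin \o f) ->
  mu.-integrable setT (EFin \o (fun x => f (c - x))).
Proof.
move=> /integrableP[mf fi]; apply/integrableP; split.
  exact: (measurableT_comp mf (measurable_reflection c)).
suff <- : (\int[pushforward mu (reflection c)]_x `|(f x)%:E| =
    \int[mu]_x `|(f (c - x))%:E|)%E.
  rewrite (@eq_measure_integral _ _ _ _ mu)// => A mA _.
  exact: lebesgue_measure_reflection.
rewrite ge0_integral_pushforward//; exact: (measurableT_comp _ mf).
Qed.

Lemma Rintegral_reflection (c : R) (f : R -> R) :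
  mu.-integrable setT (EFin \o f) ->
  \int[mu]_x f (c - x) = \int[mu]_x f x.
Proof.
move=> fi; rewrite /Rintegral; congr fine.
transitivity (\int[pushforward mu (reflection c)]_x (f x)%:E)%E.
  rewrite (integral_pushforward (measurable_reflection c))//.
    exact: measurable_int fi.
  exact: integrable_reflection.
by apply: eq_measure_integral => A mA _; exact: lebesgue_measure_reflection.
Qed.

End reflection.

(** * Gamma densities: normalisation, size-biasing, functional equation *)

Section gamma_pdf_basic.
Context {R : realType}.
Local Notation mu := (@lebesgue_measure R).
Implicit Types a b x t : R.

(** Carried as a hypothesis: the existence of a Gamma variable supplies it, and both integrability
    of the density and positivity of [gamma_fun] follow from it. *)
Definition gamma_mass1 a b := (\int[mu]_x (gamma_pdf a b x)%:E = 1)%E.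

Lemma gamma_fun_ge0 a : 0 <= gamma_fun a.
Proof. by apply: Rintegral_ge0 => t _; rewrite mulr_ge0 ?powR_ge0 ?expR_ge0. Qed.

Lemma gamma_pdf_ge0 a b x : 0 <= gamma_pdf a b x.
Proof.
rewrite /gamma_pdf; case: ifPn => // _.
by rewrite divr_ge0 ?mulr_ge0 ?powR_ge0 ?expR_ge0 ?gamma_fun_ge0.
Qed.

Lemma gamma_pdf_le0 a b x : x <= 0 -> gamma_pdf a b x = 0.
Proof. by rewrite /gamma_pdf leNgt => /negbTE ->. Qed.

Lemma gamma_pdf_expR a b x : 0 < x ->
  gamma_pdf a b x = expR ((a - 1) * ln x - x / b) / (gamma_fun a * b `^ a).
Proof.
by move=> x0; rewrite /gamma_pdf x0 /powR (gt_eqF x0) -expRD.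
Qed.

Lemma measurable_gamma_pdf a b : measurable_fun setT (gamma_pdf a b).
Proof.
apply: measurable_fun_ifT => //.
  have m0 : measurable_fun setT (fun _ : R => 0 : R) by exact: measurable_cst.
  have mid : measurable_fun setT (fun x : R => x : R) by exact: measurable_id.
  exact: (measurable_fun_ltr m0 mid).
apply: measurable_funM => //; apply: measurable_funM => //.
apply: measurableT_comp => //; apply: measurableT_comp => //.
exact: measurable_funM.
Qed.

(** Were the constant 0, the convention [0^-1 = 0] would make the density vanish identically,
    contradicting mass 1. *)
Lemma gamma_fun_gt0 a b : gamma_mass1 a b -> 0 < gamma_fun a.
Proof.
move=> h; rewrite lt0r gamma_fun_ge0 andbT; apply/eqP => a0.
have := h; rewrite /gamma_mass1 integral0_eq => [/esym/eqP|x _].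
  by rewrite onee_eq0.
by rewrite /gamma_pdf a0 mul0r invr0 mulr0 if_same.
Qed.

Lemma integrable_gamma_pdf a b : gamma_mass1 a b ->
  mu.-integrable setT (EFin \o gamma_pdf a b).
Proof.
move=> h; apply/integrableP; split.
  by apply/measurable_EFinP; exact: measurable_gamma_pdf.
under eq_integral do rewrite /= ger0_norm ?gamma_pdf_ge0//.
by rewrite h ltry.
Qed.

Lemma Rintegral_gamma_pdf a b : gamma_mass1 a b ->
  \int[mu]_x gamma_pdf a b x = 1.
Proof. by rewrite /Rintegral => ->. Qed.

(** Size-biasing, which reduces each moment to the total mass of a Gamma density of higher shape. *)
Lemma mulr_gamma_pdf a b x : 0 < b -> 0 < gamma_fun a -> 0 < gamma_fun (a + 1) ->
  x * gamma_pdf a b x =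
  gamma_fun (a + 1) / gamma_fun a * b * gamma_pdf (a + 1) b x.
Proof.
move=> b0 ga ga1; have [x0|x0] := leP x 0.
  by rewrite !gamma_pdf_le0// !mulr0.
rewrite !gamma_pdf_expR// addrK.
have -> : expR (a * ln x - x / b) = x * expR ((a - 1) * ln x - x / b).
  by rewrite -[in RHS](@lnK _ x)// -expRD; congr expR; rewrite ?lnK//; lra.
have -> : b `^ (a + 1) = b * b `^ a.
  by rewrite addrC powRD ?powRr1 ?(ltW b0)// (gt_eqF b0) implybT.
have := powR_gt0 a b0; move: (b `^ a) => B B0.
by field; rewrite !gt_eqF.
Qed.

Lemma Rintegral_gamma_pdf_mean a b : 0 < b ->
  gamma_mass1 a b -> gamma_mass1 (a + 1) b ->
  mu.-integrable setT (EFin \o (fun x => x * gamma_pdf a b x)) /\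
  \int[mu]_x (x * gamma_pdf a b x) = gamma_fun (a + 1) / gamma_fun a * b.
Proof.
move=> b0 h h1.
have ga := gamma_fun_gt0 h; have ga1 := gamma_fun_gt0 h1.
have E : (fun x => x * gamma_pdf a b x) = (fun x =>
    gamma_fun (a + 1) / gamma_fun a * b * gamma_pdf (a + 1) b x).
  by apply/funext => x; exact: mulr_gamma_pdf.
rewrite E; split.
  have := integrableZl measurableT (gamma_fun (a + 1) / gamma_fun a * b)
    (integrable_gamma_pdf h1).
  by apply: eq_integrable.
by rewrite RintegralZl ?Rintegral_gamma_pdf ?mulr1//; exact: integrable_gamma_pdf.
Qed.

(* Tilting by [expR (- (s - 1) * x)] changes the scale from [1] to [s^-1]; the
   tangent bound [1 + y <= expR y] makes [expR (- (a * u))] dominate a function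
   of [u] touching it at [u = 0], so that their derivatives agree there. *)
Lemma gamma_funD1 a : (forall b, 0 < b -> gamma_mass1 a b) ->
  gamma_mass1 (a + 1) 1 ->
  gamma_fun (a + 1) = a * gamma_fun a.
Proof.
move=> h h1; have ha1 := h 1 ltr01.
have ga := gamma_fun_gt0 ha1.
have [ix Ex] := Rintegral_gamma_pdf_mean ltr01 ha1 h1.
set M := gamma_fun (a + 1) / gamma_fun a; rewrite mulr1 -/M in Ex.
suff Ma : M = a by apply/esym; rewrite -[X in X * _]Ma /M divfK// gt_eqF.
(* The tilt is parametrised by [s = expR u], so that the normalising factor becomes
   [expR (- a * u)]; integrating the pointwise tangent inequality gives the bound. *)
have bound u : 1 - (expR u - 1) * M <= expR (- a * u).
  have hu := h _ (expR_gt0 (- u)).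
  pose g x := gamma_pdf a 1 x - (expR u - 1) * (x * gamma_pdf a 1 x).
  have iz : mu.-integrable setT
      (EFin \o (fun x => (expR u - 1) * (x * gamma_pdf a 1 x))).
    have := integrableZl measurableT (expR u - 1) ix.
    by apply: eq_integrable.
  have ig : mu.-integrable setT (EFin \o g).
    have := integrableB measurableT (integrable_gamma_pdf ha1) iz.
    by apply: eq_integrable.
  have iw : mu.-integrable setT
      (EFin \o (fun x => expR (- a * u) * gamma_pdf a (expR (- u)) x)).
    have := integrableZl measurableT (expR (- a * u)) (integrable_gamma_pdf hu).
    by apply: eq_integrable.
  have := le_Rintegral measurableT ig iw.
  rewrite RintegralB//; last exact: integrable_gamma_pdf.
  rewrite !RintegralZl//; last exact: integrable_gamma_pdf.
  rewrite !Rintegral_gamma_pdf// Ex mulr1; apply => x _.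
  rewrite /g; have [x0|x0] := leP x 0.
    by rewrite !gamma_pdf_le0// !mulr0 subr0.
  rewrite !gamma_pdf_expR// powR1 mulr1 divr1.
  have -> : expR (- u) `^ a = expR (- a * u).
    by rewrite -expRM; congr expR; lra.
  rewrite expRN invrK.
  have -> : expR ((a - 1) * ln x - x * expR u) =
      expR ((a - 1) * ln x - x) * expR (- ((expR u - 1) * x)).
    by rewrite -expRD; congr expR; lra.
  set e := expR (_ - x).
  have := expR_ge1Dx (- ((expR u - 1) * x)).
  move: (expR (- (_ * x))) => y hy.
  have -> : e / gamma_fun a - (expR u - 1) * (x * (e / gamma_fun a)) =
    e / gamma_fun a * (1 - (expR u - 1) * x) by lra.
  have -> : expR (- a * u) * (e * y / (gamma_fun a * expR (- a * u))) =
     e / gamma_fun a * y.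
    by field; rewrite !gt_eqF ?expR_gt0.
  rewrite ler_wpM2l// divr_ge0 ?expR_ge0// ltW//.
pose phi u := expR (- a * u) + (expR u - 1) * M.
have dphi (u : R) : is_derive u 1 phi (- a * expR (- a * u) + expR u * M).
  by apply: is_derive_eq; rewrite /GRing.scale/=; lra.
have d0 : is_derive (0 : R) 1 phi 0.
  apply: (@derive1_at_min _ phi (-1) 1) => //.
  by rewrite in_itv/=; lra.
  move=> t _; rewrite /phi mulr0 expR0 subrr mul0r addr0.
  by have := bound t; lra.
have := dphi 0; rewrite mulr0 expR0.
move=> d1.
have := @derive_val _ _ _ _ _ _ _ d0.
rewrite (@derive_val _ _ _ _ _ _ _ d1); lra.
Qed.

End gamma_pdf_basic.

(** * The density at two points symmetric about the mean *)

Section gamma_pdf_reflection.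
Context {R : realType}.
Implicit Types a b c m s t : R.

(** For [0 < t < m], the log of the ratio of the densities at [m + t] and [m - t] is
    [(a - 1) * log_ratio m t - 2 * t / b]. *)
Let log_ratio m t := ln (m + t) - ln (m - t).

Let log_ratioB m s t : 0 <= s < t -> t < m ->
  exists2 x, s < x < t &
    log_ratio m t - log_ratio m s = ((m + x)^-1 + (m - x)^-1) * (t - s).
Proof.
move=> /andP[s0 st] tm.
have d x : - m < x < m ->
    is_derive x 1 (log_ratio m) ((m + x)^-1 + (m - x)^-1).
  move=> /andP[xm mx].
  have h1 : 0 < m + x by lra.
  have h2 : 0 < m - x by lra.
  have d1 : is_derive x 1 (fun x => ln (m + x)) ((m + x)^-1).
    have := is_derive1_ln h1 => ?.
    by apply: is_derive_eq; rewrite /GRing.scale/=; lra.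
  have d2 : is_derive x 1 (fun x => ln (m - x)) (- (m - x)^-1).
    have := is_derive1_ln h2 => ?.
    by apply: is_derive_eq; rewrite /GRing.scale/=; lra.
  by apply: is_derive_eq; lra.
have dst x : s <= x <= t ->
    is_derive x 1 (log_ratio m) ((m + x)^-1 + (m - x)^-1).
  by move=> sxt; apply: d; lra.
have cont : {within `[s, t], continuous (log_ratio m)}.
  apply: derivable_within_continuous => x; rewrite in_itv/= => sxt.
  by apply: ex_derive; exact: dst.
have doo x : x \in `]s, t[ ->
    is_derive x 1 (log_ratio m) ((m + x)^-1 + (m - x)^-1).
  by rewrite in_itv/= => /andP[sx xt]; apply: dst; rewrite !ltW.
have [x] := MVT st doo cont.
by rewrite in_itv/= => sxt E; exists x.
Qed.

Let log_ratioE m t : 0 < t < m ->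
  exists2 x, 0 < x < t & log_ratio m t = ((m + x)^-1 + (m - x)^-1) * t.
Proof.
move=> /andP[t0 tm].
have [|x xt] := @log_ratioB m 0 t _ tm; first by rewrite lexx.
by rewrite {2}/log_ratio addr0 !subr0 subrr subr0 => E; exists x.
Qed.

Let slopeE m x : - m < x < m ->
  (m + x)^-1 + (m - x)^-1 = 2 * m / (m ^+ 2 - x ^+ 2).
Proof.
move=> h; have h1 : 0 < m + x by lra.
have h2 : 0 < m - x by lra.
have -> : m ^+ 2 - x ^+ 2 = (m + x) * (m - x) by ring.
by field; rewrite !gt_eqF.
Qed.

(** The slope [2 * m / (m ^+ 2 - x ^+ 2)] is least at [x = 0], where it equals [2 / m]. *)
Let log_ratio_ge m t : 0 < t < m -> 2 * t / m <= log_ratio m t.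
Proof.
move=> tm; have [x xt ->] := log_ratioE tm.
rewrite slopeE; last lra.
rewrite mulrAC ler_wpM2r//; first lra.
have d0 : 0 < m ^+ 2 - x ^+ 2 by nra.
rewrite ler_pdivlMr// mulrAC ler_pdivrMr; last lra.
nra.
Qed.

(** For [a > 1], the slope at [x < b] is at most its value at [b], and [a - 1] times that value is
    [2 * a / ((a + 1) * b)], below [2 / b]. This provides a point before the crossing. *)
Let log_ratio_small a b t : 0 < a -> 0 < t -> t <= b -> t < a * b ->
  (a - 1) * log_ratio (a * b) t <= 2 * t / b.
Proof.
move=> a0 t0 tb tm.
have lr0 : 0 <= log_ratio (a * b) t.
  apply: le_trans (log_ratio_ge _); last lra.
  by rewrite divr_ge0//; lra.
have b0 : 0 < b by lra.
have [a1|a1] := leP a 1.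
  apply: (@le_trans _ _ 0); first by rewrite mulr_le0_ge0//; lra.
  by rewrite divr_ge0//; lra.
have [|x xt ->] := @log_ratioE (a * b) t; first lra.
rewrite slopeE; last lra.
have xb : x ^+ 2 <= b ^+ 2 by rewrite ler_sqr ?nnegrE; lra.
have bm : 0 <= b * (a * b - b) by rewrite mulr_ge0//; nra.
have d0 : 0 < (a * b) ^+ 2 - x ^+ 2 by nra.
rewrite [leLHS]mulrA [leRHS]mulrAC ler_wpM2r//; first lra.
rewrite ler_pdivlMr// mulrAC [leLHS]mulrA ler_pdivrMr//.
nra.
Qed.

(** Convexity when [k > 0]: a failure at [s] means an average slope above [l] on [[0, s]], hence
    also on [[s, t]], and so a failure at [t]. *)
Let log_ratio_down_closed k l m s t : 0 < s < t -> t < m ->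
  0 <= l -> k * log_ratio m t <= l * t -> k * log_ratio m s <= l * s.
Proof.
move=> /andP[s0 st] tm l0 ht.
have sm : 0 < s < m by lra.
have lr0 : 0 <= log_ratio m s.
  by apply: le_trans (log_ratio_ge sm); rewrite divr_ge0//; lra.
have [k0|k0] := leP k 0.
  by apply: (@le_trans _ _ 0); [rewrite mulr_le0_ge0|rewrite mulr_ge0//; lra].
have [x xs Ex] := log_ratioE sm.
have [|y yt Ey] := @log_ratioB m s t _ tm; first by rewrite (ltW s0).
rewrite leNgt; apply/negP => hs.
have slope_le : (m + x)^-1 + (m - x)^-1 <= (m + y)^-1 + (m - y)^-1.
  rewrite !slopeE; [|lra..]; rewrite ler_pM2l; last lra.
  by rewrite lef_pV2 ?posrE; nra.
move: Ex Ey slope_le; move: (_ + (m - x)^-1) => p.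
move: (_ + (m - y)^-1) => q Ex Ey pq.
have lp : l < k * p by rewrite Ex mulrA ltr_pM2r in hs.
have lq : l < k * q by rewrite (lt_le_trans lp)// ler_pM2l.
have : l * (t - s) < k * q * (t - s) by rewrite ltr_pM2r//; lra.
nra.
Qed.

Let gamma_pdfB_le a b m t : 0 < b -> 0 < gamma_fun a -> 0 < t < m ->
  (gamma_pdf a b (m + t) <= gamma_pdf a b (m - t)) =
  ((a - 1) * log_ratio m t <= 2 / b * t).
Proof.
move=> b0 ga tm; rewrite !gamma_pdf_expR; [|lra..].
rewrite ler_pM2r; last by rewrite invr_gt0 mulr_gt0 ?powR_gt0.
by rewrite ler_expR /log_ratio; apply/idP/idP; lra.
Qed.

(** The bound of [c] by the mean later gives strict positivity of the folded integrand left of 0. *)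
Lemma gamma_pdf_single_crossing a b : 0 < a -> 0 < b -> 0 < gamma_fun a ->
  exists2 c, 0 < c <= a * b & forall t, 0 < t ->
    (t < c -> gamma_pdf a b (a * b + t) <= gamma_pdf a b (a * b - t)) /\
    (c < t -> gamma_pdf a b (a * b - t) <= gamma_pdf a b (a * b + t)).
Proof.
move=> a0 b0 ga; set m := a * b.
have m0 : 0 < m by rewrite mulr_gt0.
(* [S] is closed downwards within []0, m[], so its supremum is the crossing distance. Halving the
   minimum in [t0] keeps it strictly below [m]. *)
pose S := [set t | 0 < t < m /\ (a - 1) * log_ratio m t <= 2 / b * t].
pose t0 := Num.min b m / 2.
have mn0 : 0 < Num.min b m by rewrite lt_min b0.
have mnb : Num.min b m <= b by rewrite ge_min lexx.
have mnm : Num.min b m <= m by rewrite ge_min lexx orbT.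
have St0 : S t0.
  split; first by rewrite /t0; lra.
  rewrite mulrAC; apply: log_ratio_small => //; rewrite -/m /t0; lra.
have ubS : has_ubound S by exists m => t [/andP[_ /ltW]].
have supS : has_sup S by split => //; exists t0.
exists (sup S).
  rewrite (lt_le_trans _ (ub_le_sup ubS St0)); last by rewrite /t0; lra.
  by apply: ge_sup => [|t [/andP[_ /ltW]]//]; exists t0.
move=> t t_gt0; split => [tc|ct].
- have [s Ss ts] := sup_adherent (ltac:(lra) : 0 < sup S - t) supS.
  rewrite subKr in ts.
  have [sm hs] := Ss.
  rewrite gamma_pdfB_le//; last lra.
  apply: (@log_ratio_down_closed _ _ _ t s) => //; [lra|lra|].
  by rewrite divr_ge0// ltW.
- have [mt|tm] := leP m t.
    (* From [t = m] on, the left point is outside the support. *)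
    by rewrite (gamma_pdf_le0 a b (_ : m - t <= 0)) ?gamma_pdf_ge0//; lra.
  rewrite leNgt; apply/negP => /ltW.
  rewrite gamma_pdfB_le// ?t_gt0// => ht.
  have : t <= sup S by apply: ub_le_sup => //; split => //; rewrite t_gt0.
  lra.
Qed.

(** For [a >= 1] the log of the density ratio is at least [- 2 * t / (a * b)]; conclude by
    [1 - expR y <= - y]. *)
Lemma gamma_pdf_reflectB a b t : 1 <= a -> 0 < b -> 0 < t ->
  gamma_pdf a b (a * b - t) - gamma_pdf a b (a * b + t) <=
  2 * t / (a * b) * gamma_pdf a b (a * b - t).
Proof.
move=> a1 b0 t0; set m := a * b.
have m0 : 0 < m by rewrite mulr_gt0//; lra.
have [mt|tm] := leP m t.
  rewrite (gamma_pdf_le0 a b (_ : m - t <= 0)); last lra.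
  by rewrite mulr0 sub0r oppr_le0 gamma_pdf_ge0.
have -> : gamma_pdf a b (m + t) =
    expR ((a - 1) * log_ratio m t - 2 * t / b) * gamma_pdf a b (m - t).
  rewrite !gamma_pdf_expR; [|lra..].
  by rewrite mulrA -expRD /log_ratio; congr (expR _ / _); lra.
rewrite -[X in X - _]mul1r -mulrBl ler_wpM2r ?gamma_pdf_ge0//.
have := expR_ge1Dx ((a - 1) * log_ratio m t - 2 * t / b).
have : (a - 1) * (2 * t / m) <= (a - 1) * log_ratio m t.
  by rewrite ler_wpM2l ?log_ratio_ge//; lra.
have -> : (a - 1) * (2 * t / m) = 2 * t / b - 2 * t / m.
  by rewrite /m; field; rewrite !gt_eqF//; lra.
lra.
Qed.

End gamma_pdf_reflection.

(** * Strict positivity, folding and sign weights *)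

Section integral_sign.
Context {R : realType}.
Local Notation mu := (@lebesgue_measure R).
Implicit Types (f g : R -> R) (m c : R).

(** A zero integral would make [g] vanish almost everywhere, but [g] is positive on []-1, 0[], which
    has measure 1. *)
Lemma Rintegral_gt0 g : mu.-integrable setT (EFin \o g) ->
  (forall x, 0 <= g x) -> (forall x, x < 0 -> 0 < g x) ->
  0 < \int[mu]_x g x.
Proof.
move=> ig g0 gN; rewrite lt0r Rintegral_ge0// andbT; apply/eqP => I0.
have mg := measurable_int _ ig.
have : (\int[mu]_x `|(g x)%:E| = 0)%E.
  under eq_integral do rewrite /= ger0_norm//.
  by rewrite -[LHS]fineK ?integrable_fin_num// -/(Rintegral _ _ _) I0.
move=> /(ae_eq_integral_abs mu measurableT mg)[N [mN N0 gN0]].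
have : (mu `](-1)%R, 0%R[%classic <= mu N)%E.
  apply: le_measure; rewrite ?inE//; apply: subset_trans gN0 => x /=.
  rewrite in_itv/= => /andP[_ x0] /(_ I)[] E.
  by have := gN _ x0; rewrite E ltxx.
rewrite N0 lebesgue_measure_itv/= lte_fin ltrN10 -EFinB sub0r opprK lee_fin.
by rewrite leNgt ltr01.
Qed.

Lemma Rintegral_symmetrize c g : mu.-integrable setT (EFin \o g) ->
  mu.-integrable setT (EFin \o (fun x => g x + g (c - x))) /\
  \int[mu]_x (g x + g (c - x)) = 2 * \int[mu]_x g x.
Proof.
move=> ig; have ig' := integrable_reflection c ig; split.
  have := integrableD measurableT ig ig'.
  by apply: eq_integrable.
by rewrite RintegralD// Rintegral_reflection//; lra.
Qed.

(** [Num.sg (m - x)] is the sum of the indicators of []-oo, m[] and []-oo, m]], minus 1; the two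
    indicators give the same integral. *)
Lemma Rintegral_sg m f : mu.-integrable setT (EFin \o f) ->
  mu.-integrable setT (EFin \o (fun x => Num.sg (m - x) * f x)) /\
  \int[mu]_x (Num.sg (m - x) * f x) =
    2 * \int[mu]_(x in `]-oo, m]) f x - \int[mu]_x f x.
Proof.
move=> fi.
pose fo := f \_ `]-oo, m[; pose fc := f \_ `]-oo, m].
have ifo : mu.-integrable setT (EFin \o fo).
  rewrite -restrict_EFin -integrable_restrict//= setTI.
  exact: integrableS fi.
have ifc : mu.-integrable setT (EFin \o fc).
  rewrite -restrict_EFin -integrable_restrict//= setTI.
  exact: integrableS fi.
have ifd : mu.-integrable setT (EFin \o (fun x => fo x + fc x)).
  have := integrableD measurableT ifo ifc.
  by apply: eq_integrable.
have E x : Num.sg (m - x) * f x = (fo x + fc x) - f x.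
  have memo : (x \in `]-oo, m[%classic) = (x < m).
    by apply/idP/idP; rewrite inE/= in_itv.
  have memc : (x \in `]-oo, m]%classic) = (x <= m).
    by apply/idP/idP; rewrite inE/= in_itv.
  (* Outside its domain a restriction takes the default value [point]. *)
  have pt0 : point = 0 :> R by [].
  rewrite /fo /fc !patchE memo memc !pt0; have [xm|xm|->] := ltgtP x m.
  - by rewrite gtr0_sg ?subr_gt0//; lra.
  - by rewrite ltr0_sg ?subr_lt0//; lra.
  - by rewrite subrr sgr0; lra.
under eq_Rintegral do rewrite E.
split.
  have := integrableB measurableT ifd fi.
  by apply: eq_integrable => // x _ /=; rewrite E.
rewrite RintegralB// RintegralD// -!Rintegral_mkcond.
rewrite Rintegral_itv_bndo_bndc; first by rewrite mulr_natl.
exact: integrableS fi.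
Qed.

End integral_sign.

(** * Bounds on the distribution function at the mean *)

Section gamma_cdf_at_mean.
Context {R : realType}.
Local Notation mu := (@lebesgue_measure R).
Context (mass1 : forall a b : R, 0 < a -> 0 < b -> gamma_mass1 a b).
Implicit Types a b k x : R.

Lemma gamma_mean a b : 0 < a -> 0 < b ->
  mu.-integrable setT (EFin \o (fun x => x * gamma_pdf a b x)) /\
  \int[mu]_x (x * gamma_pdf a b x) = a * b.
Proof.
move=> a0 b0; have a1 : 0 < a + 1 by lra.
have [i ->] := Rintegral_gamma_pdf_mean b0 (mass1 a0 b0) (mass1 a1 b0).
have ga := gamma_fun_gt0 (mass1 a0 b0).
split => //; rewrite gamma_funD1; first by rewrite mulfK// gt_eqF.
- by move=> ? ?; exact: mass1.
- exact: mass1.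
Qed.

Lemma gamma_moment2 a b : 0 < a -> 0 < b ->
  mu.-integrable setT (EFin \o (fun x => x ^+ 2 * gamma_pdf a b x)) /\
  \int[mu]_x (x ^+ 2 * gamma_pdf a b x) = a * b * ((a + 1) * b).
Proof.
move=> a0 b0; have a1 : 0 < a + 1 by lra.
have ga := gamma_fun_gt0 (mass1 a0 b0); have ga1 := gamma_fun_gt0 (mass1 a1 b0).
have E x : x ^+ 2 * gamma_pdf a b x = a * b * (x * gamma_pdf (a + 1) b x).
  rewrite expr2 -mulrA mulr_gamma_pdf// gamma_funD1 ?mulfK ?gt_eqF//; first by ring.
  - by move=> ? ?; exact: mass1.
  - exact: mass1.
have [i I] := gamma_mean a1 b0.
split.
  have := integrableZl measurableT (a * b) i.
  by apply: eq_integrable => // x _ /=; rewrite E.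
under eq_Rintegral do rewrite E.
by rewrite RintegralZl// I.
Qed.

Let F a b := \int[mu]_(x in `]-oo, (a * b)]) gamma_pdf a b x.

(** One computation for both bounds: the lower one uses a linear correction of the sign, the upper
    one a quadratic correction. *)
Let Rintegral_weighted a b k0 k1 k2 : 0 < a -> 0 < b ->
  let g x := (Num.sg (a * b - x) + (k0 + k1 * x + k2 * x ^+ 2)) *
    gamma_pdf a b x in
  mu.-integrable setT (EFin \o g) /\
  \int[mu]_x g x = (2 * F a b - 1) +
    (k0 + k1 * (a * b) + k2 * (a * b * ((a + 1) * b))).
Proof.
move=> a0 b0 g.
have [i1 I1] := gamma_mean a0 b0.
have [i2 I2] := gamma_moment2 a0 b0.
have i0 := integrable_gamma_pdf (mass1 a0 b0).
have I0 := Rintegral_gamma_pdf (mass1 a0 b0).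
have [is_ Is] := Rintegral_sg (a * b) i0.
have add (g1 g2 : R -> R) : mu.-integrable setT (EFin \o g1) ->
    mu.-integrable setT (EFin \o g2) ->
    mu.-integrable setT (EFin \o (fun x => g1 x + g2 x)).
  move=> h1 h2; have := integrableD measurableT h1 h2.
  by apply: eq_integrable.
have scale k (g1 : R -> R) : mu.-integrable setT (EFin \o g1) ->
    mu.-integrable setT (EFin \o (fun x => k * g1 x)).
  move=> h1; have := integrableZl measurableT k h1.
  by apply: eq_integrable.
have gE : g = (fun x => Num.sg (a * b - x) * gamma_pdf a b x +
    (k0 * gamma_pdf a b x + (k1 * (x * gamma_pdf a b x) +
      k2 * (x ^+ 2 * gamma_pdf a b x)))).
  by apply/funext => x; rewrite /g; ring.
have j0 := scale k0 _ i0; have j1 := scale k1 _ i1; have j2 := scale k2 _ i2.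
have j12 := add _ _ j1 j2; have j012 := add _ _ j0 j12.
rewrite gE; split; first exact: add.
rewrite !RintegralD// !RintegralZl// Is I0 I1 I2 /F; ring.
Qed.

Lemma gamma_cdf_mean_gt_half a b : 0 < a -> 0 < b -> 2^-1 < F a b.
Proof.
move=> a0 b0; set m := a * b.
have ga := gamma_fun_gt0 (mass1 a0 b0).
have [c /andP[c0 cm] cross] := gamma_pdf_single_crossing a0 b0 ga.
rewrite -/m in cm cross.
(* These coefficients spell [- (m - x) / c], whose integral against the density is 0. *)
have [ig Ig] := @Rintegral_weighted a b (- (m / c)) c^-1 0 a0 b0.
have [] := Rintegral_symmetrize (2 * m) ig.
rewrite [X in _ = 2 * X](_ : _ = 2 * F a b - 1); last first.
  by apply: (etrans Ig); rewrite -/m; field; rewrite gt_eqF.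
set G := fun x => _ => iG IG.
have GE x : G x = (Num.sg (m - x) - (m - x) / c) *
    (gamma_pdf a b x - gamma_pdf a b (2 * m - x)).
  rewrite /G -/m (_ : m - (2 * m - x) = - (m - x)); last by ring.
  by rewrite sgrN; ring.
have G_sym x : G (2 * m - x) = G x.
  by rewrite /G (_ : 2 * m - (2 * m - x) = x) 1?addrC//; ring.
have G_ge0 t : 0 < t -> 0 <= G (m - t).
  move=> t0; rewrite GE subKr gtr0_sg// (_ : 2 * m - (m - t) = m + t); last by ring.
  have [h1 h2] := cross _ t0.
  have [tc|ct|->] := ltgtP t c.
  (* The weight [1 - t / c] and the density difference change sign together at [c]. *)
  - by rewrite mulr_ge0// subr_ge0 ?h1// ler_pdivrMr// mul1r ltW.
  - by rewrite mulr_le0// subr_le0 ?h2// ler_pdivlMr// mul1r ltW.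
  - by rewrite divff ?gt_eqF// subrr mul0r.
suff : 0 < \int[mu]_x G x by rewrite IG; lra.
apply: Rintegral_gt0 => // x.
- have [xm|xm|->] := ltgtP x m.
  + by rewrite -(subKr m x) G_ge0// subr_gt0.
  + rewrite -G_sym (_ : 2 * m - x = m - (x - m)); last by ring.
    by rewrite G_ge0// subr_gt0.
  + by rewrite GE subrr mul0r sgr0 subrr mul0r.
(* Here the density vanishes at [x] but not at [2 * m - x], and [m - x > m >= c] makes the weight
   negative: a product of two negative factors. *)
- move=> x0; rewrite GE gtr0_sg; last by rewrite subr_gt0 (lt_trans x0)// mulr_gt0.
  rewrite (gamma_pdf_le0 a b (ltW x0)) sub0r nmulr_rgt0.
    rewrite oppr_lt0 gamma_pdf_expR; last by rewrite /m; nra.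
    by rewrite divr_gt0 ?expR_gt0// mulr_gt0// powR_gt0.
  by rewrite subr_lt0 ltr_pdivlMr// mul1r; lra.
Qed.

(** With scale 1, [s] is the standard deviation, the choice that balances the two terms of
    [Var X / s + s]. *)
Lemma gamma_cdf_mean_le s : 1 <= s -> F (s ^+ 2) 1 <= 2^-1 + s^-1.
Proof.
move=> s1; set m := s ^+ 2.
have s0 : 0 < s by lra.
have m1 : 1 <= m by rewrite /m expr_ge1//; lra.
have m0 : 0 < m by lra.
(* The coefficients of [- ((m - x) ^+ 2 / s + s) / m], which integrates to [- 2 / s] because the
   variance is [m = s ^+ 2]. *)
pose k0 := - ((m ^+ 2 / s + s) / m).
pose k1 := 2 / s.
pose k2 := - (s * m)^-1.
have [ig Ig] := @Rintegral_weighted m 1 k0 k1 k2 m0 ltr01.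
have [] := Rintegral_symmetrize (2 * m) ig.
rewrite [X in _ = 2 * X](_ : _ = 2 * F m 1 - 1 - 2 / s); last first.
  by apply: (etrans Ig); rewrite /k0 /k1 /k2 /m; field; rewrite gt_eqF.
set G := fun x => _ => iG IG.
pose f := gamma_pdf m 1.
pose v x := ((m - x) ^+ 2 / s + s) / m.
have kE x : k0 + k1 * x + k2 * x ^+ 2 = - v x.
  by rewrite /k0 /k1 /k2 /v; field; rewrite !gt_eqF.
have GE x : G x = Num.sg (m - x) * (f x - f (2 * m - x)) -
    v x * (f x + f (2 * m - x)).
  rewrite /G !kE /v !mulr1 (_ : m - (2 * m - x) = - (m - x)); last by ring.
  by rewrite sgrN sqrrN /f; ring.
have G_sym x : G (2 * m - x) = G x.
  by rewrite /G (_ : 2 * m - (2 * m - x) = x) 1?addrC//; ring.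
have G_le0 t : 0 < t -> G (m - t) <= 0.
  move=> t0; rewrite GE subKr gtr0_sg// (_ : 2 * m - (m - t) = m + t); last by ring.
  have := gamma_pdf_reflectB m1 ltr01 t0; rewrite !mulr1 -/f.
  have h : 2 * t / m <= v (m - t).
    rewrite /v subKr ler_pM2r ?invr_gt0//.
    have -> : t ^+ 2 / s + s = 2 * t + (t - s) ^+ 2 / s.
      by field; rewrite gt_eqF.
    by rewrite lerDl divr_ge0 ?sqr_ge0// ltW.
  have := gamma_pdf_ge0 m 1 (m - t); have := gamma_pdf_ge0 m 1 (m + t); rewrite -/f.
  have : 0 <= 2 * t / m by rewrite divr_ge0//; lra.
  move: h (f (m - t)) (f (m + t)) => h p q t0' q0 p0 pq.
  have : 2 * t / m * p <= v (m - t) * p by rewrite ler_wpM2r.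
  have : 0 <= v (m - t) * q by rewrite mulr_ge0//; lra.
  lra.
have : \int[mu]_x G x <= \int[mu]_x (0 : R).
  apply: le_Rintegral => //; first exact: integrable0.
  move=> x _; have [xm|xm|->] := ltgtP x m.
  - by rewrite -(subKr m x) G_le0// subr_gt0.
  - rewrite -G_sym (_ : 2 * m - x = m - (x - m)); last by ring.
    by rewrite G_le0// subr_gt0.
  - rewrite GE subrr sgr0 mul0r sub0r oppr_le0 mulr_ge0//.
      by rewrite /v divr_ge0 ?addr_ge0 ?divr_ge0 ?sqr_ge0//; lra.
    by rewrite addr_ge0// gamma_pdf_ge0.
rewrite IG Rintegral_cst// mul0r.
lra.
Qed.

End gamma_cdf_at_mean.

(** * From the random variable to its density *)

Section gamma_distributed_theory.
Context {R : realType} {d : measure_display} {T : measurableType d}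
  (P : probability T R) (X : {RV P >-> R}) (a b : R).
Local Notation mu := (@lebesgue_measure R).
Context (hX : gamma_distributed X a b).

Lemma gamma_distributed_mass1 : gamma_mass1 a b.
Proof. by rewrite /gamma_mass1 -hX//= probability_setT. Qed.

Lemma ge0_expectation_gamma (f : R -> R) : measurable_fun setT f ->
  (forall x, 0 <= f x) ->
  (\int[P]_w (f (X w))%:E = \int[mu]_x (f x * gamma_pdf a b x)%:E)%E.
Proof.
move=> mf f0.
have mEf : measurable_fun setT (EFin \o f) by exact/measurable_EFinP.
have Ef0 x : (0 <= (EFin \o f) x)%E by rewrite lee_fin.
have mpdf : measurable_fun setT (EFin \o gamma_pdf a b).
  by apply/measurable_EFinP; exact: measurable_gamma_pdf.
(* [lebesgue_measure] lives on [measurableTypeR R], whose display differs from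
   that of the codomain of [X], so [X] is retyped. *)
have mX : measurable_fun setT (X : T -> measurableTypeR R).
  exact: (@measurable_funPT _ _ _ _ X).
pose X_mixin := isMeasurableFun.Build _ _ _ _ _ mX.
pose Y : {RV P >-> measurableTypeR R} :=
  HB.pack (X : T -> measurableTypeR R) X_mixin.
transitivity (\int[distribution P Y]_x (EFin \o f) x)%E.
  by rewrite (ge0_integral_distribution Y mEf Ef0).
exact: (ge0_integral_density (nu := distribution P Y) mpdf hX mEf Ef0).
Qed.

(** Positive and negative parts are transferred separately; the negative one contributes 0 because
    the density vanishes on []-oo, 0]]. *)
Lemma expectation_gamma :
  mu.-integrable setT (EFin \o (fun x => x * gamma_pdf a b x)) ->
  ('E_P[X] = (\int[mu]_x (x * gamma_pdf a b x))%:E)%E.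
Proof.
move=> ix; rewrite unlock integralE.
have mid : measurable_fun setT (fun x : R => x : R) by exact: measurable_id.
have m0 : measurable_fun setT (fun _ : R => 0 : R) by exact: measurable_cst.
have -> : (\int[P]_w (fun w => (X w)%:E)^\+ w =
    \int[mu]_x (x * gamma_pdf a b x)%:E)%E.
  transitivity (\int[P]_w (Num.max (X w) 0)%:E)%E.
    by apply: eq_integral => w _; rewrite funeposE EFin_max.
  rewrite (@ge0_expectation_gamma (fun x => Num.max x 0)).
  - apply: eq_integral => x _; congr EFin; have [//|x0] := leP 0 x.
    by rewrite gamma_pdf_le0 ?mulr0// ltW.
  - exact: measurable_maxr.
  - by move=> x; rewrite le_max lexx orbT.
have -> : (\int[P]_w (fun w => (X w)%:E)^\- w = 0)%E.
  transitivity (\int[P]_w (Num.max (- X w) 0)%:E)%E.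
    by apply: eq_integral => w _; rewrite funenegE -EFinN EFin_max.
  rewrite (@ge0_expectation_gamma (fun x => Num.max (- x) 0)).
  - apply: integral0_eq => x _; have [x0|x0] := leP x 0.
      by rewrite gamma_pdf_le0 ?mulr0.
    by rewrite max_r ?mul0r// oppr_le0 ltW.
  - by apply: measurable_maxr => //; exact: measurable_oppr.
  - by move=> x; rewrite le_max lexx orbT.
by rewrite sube0 -[LHS]fineK// integrable_fin_num.
Qed.

Lemma probability_gamma_le m :
  P [set w | X w <= m] = (\int[mu]_(x in `]-oo, m]) gamma_pdf a b x)%:E.
Proof.
have -> : P [set w | X w <= m] = distribution P X `]-oo, m]%classic.
  by congr (P _); apply/seteqP; split => w /=; rewrite in_itv.
rewrite hX// -[LHS]fineK// integrable_fin_num//.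
exact: integrableS (integrable_gamma_pdf gamma_distributed_mass1).
Qed.

End gamma_distributed_theory.

Local Open Scope ereal_scope.

Theorem theorem1p1 (R : realType) (d : R -> R -> measure_display)
    (T : forall a b : R, measurableType (d a b))
    (P : forall a b : R, probability (T a b) R)
    (X : forall a b : R, {RV (P a b) >-> R})
    (hX : forall a b : R, (0 < a)%R -> (0 < b)%R ->
      gamma_distributed (X a b) a b) :
  (forall a b : R, (0 < a)%R -> (0 < b)%R ->
    (2^-1)%:E < P a b [set w | (X a b w)%:E <= 'E_(P a b)[X a b]]) /\
  ereal_inf [set P a b [set w | (X a b w)%:E <= 'E_(P a b)[X a b]]
            | a in [set a : R | (0 < a)%R] & b in [set b : R | (0 < b)%R]] =
    (2^-1)%:E.
Proof.
have mass1 (a b : R) : (0 < a)%R -> (0 < b)%R -> gamma_mass1 a b.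
  by move=> a0 b0; exact: (gamma_distributed_mass1 (hX _ _ a0 b0)).
have PE (a b : R) : (0 < a)%R -> (0 < b)%R ->
    P a b [set w | (X a b w)%:E <= 'E_(P a b)[X a b]] =
    (\int[lebesgue_measure]_(x in `]-oo, (a * b)%R]) gamma_pdf a b x)%R%:E.
  move=> a0 b0; have [i I] := gamma_mean mass1 a0 b0.
  rewrite (expectation_gamma (hX _ _ a0 b0) i) I -(probability_gamma_le (hX _ _ a0 b0)).
  by congr (P a b _); apply/seteqP; split => w /=; rewrite lee_fin.
have gt_half (a b : R) : (0 < a)%R -> (0 < b)%R ->
    (2^-1)%:E < P a b [set w | (X a b w)%:E <= 'E_(P a b)[X a b]].
  by move=> a0 b0; rewrite PE// lte_fin; exact: gamma_cdf_mean_gt_half.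
split=> //; apply/eqP; rewrite eq_le; apply/andP; split; last first.
  by apply: le_ereal_inf_tmp => _ [a a0 [b b0 <-]]; exact/ltW/gt_half.
apply/lee_addgt0Pr => e e0.
(* Chosen so that [s >= 1] and [s^-1 <= e]. *)
pose s : R := (1 + e^-1)%R.
have s1 : (1 <= s)%R by rewrite lerDl invr_ge0 ltW.
have s0 : (0 < s ^+ 2)%R by rewrite exprn_gt0// (lt_le_trans _ s1).
apply: (@le_trans _ _ (P (s ^+ 2)%R 1%R
    [set w | (X (s ^+ 2)%R 1%R w)%:E <= 'E_(P (s ^+ 2)%R 1%R)[X (s ^+ 2)%R 1%R]])).
  by apply: ereal_inf_lbound; exists (s ^+ 2)%R => //; exists 1%R => //=.
rewrite PE// -EFinD lee_fin (le_trans (gamma_cdf_mean_le mass1 s1))//.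
rewrite lerD2l -[leRHS]invrK lef_pV2 ?posrE ?invr_gt0// ?(lt_le_trans ltr01)//.
by rewrite lerDr.
Qed.
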